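(* Let $A,B\in\mathbb{R}^{n\times n}$ be symmetric positive definite, let $0<\lambda_1<\lambda_2\le\dots\le\lambda_n$ be the eigenvalues of $A$, let $u_*$ be an eigenvector of $A$ associated with $\lambda_1$, and let $x_*:=B^{1/2}u_*/\|B^{1/2}u_*\|$. Consider the Riemannian steepest descent method $x_{t+1}=\exp_{x_t}(-\eta_t\operatorname{grad}f(x_t))$ for $f(x)=-\dfrac{x^{\mathsf T}B^{-1}x}{x^{\mathsf T}B^{-1/2}AB^{-1/2}x}$ on $\mathbb{S}^{n-1}$, with starting vector $x_0\in\mathbb{S}^{n-1}$ satisfying $\operatorname{dist}(x_0,x_* )<\varphi$ and step size $\eta_t=a(x_t)/\gamma(x_t)$. Then the quantity $\xi_t:=\eta_t\,\mu(x_t)\,a(x_t)$ satisfies $$\xi_\infty:=\lim_{t\to\infty}\xi_t=\frac{8}{\pi^2(1+\cos\varphi)^2}\cdot\frac{\lambda_1^{-1}-\lambda_2^{-1}}{\kappa_\nu(\lambda_1^{-1}-\lambda_n^{-1})}.$$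
   Context: Notation. $\|\cdot\|$ is the Euclidean norm and $\|v\|_C:=\sqrt{v^{\mathsf T}Cv}$ for a symmetric positive definite matrix $C$. $\mathbb{S}^{n-1}$ is the unit sphere in $\mathbb{R}^n$ with the restricted Euclidean metric. $\operatorname{grad}f(x)=(I-xx^{\mathsf T})\nabla f(x)$ is the Riemannian gradient, and $\exp_x(v)=\cos(\|v\|)x+\sin(\|v\|)v/\|v\|$ for $v\perp x$, $v\neq 0$, with $\exp_x(0)=x$. $\operatorname{dist}(x,x_* ):=\arccos(x^{\mathsf T}x_* )$. $\nu_{\min},\nu_{\max}$ are constants with $0<\nu_{\min}\le\nu_{\max}$ and $\nu_{\min}\,x^{\mathsf T}Bx\le x^{\mathsf T}Ax\le\nu_{\max}\,x^{\mathsf T}Bx$ for all $x\in\mathbb{R}^n$; $\kappa_\nu:=\nu_{\max}/\nu_{\min}$. The angle of distortion is $\varphi:=\arcsin\dfrac{\|u_*\|^2}{\|u_*\|_B\|u_*\|_{B^{-1}}}\in(0,\pi/2]$. For $x\in\mathbb{S}^{n-1}$ define $$\gamma(x)=\frac{\nu_{\max}(\lambda_1^{-1}-\lambda_n^{-1})}{\|A^{1/2}B^{-1/2}x\|^2},\qquad \mu(x)=\frac{8\nu_{\min}(\lambda_1^{-1}-\lambda_2^{-1})\|u_*\|_B}{\pi^2\|A^{1/2}B^{-1/2}x\|\,\|u_*\|_A},$$ $$a(x)=\frac{\lambda_1\|u_*\|_{B^{-1}}^2\bigl(\cos(\operatorname{dist}(x,x_* ))-\cos\varphi\bigr)}{\|A^{1/2}B^{-1/2}x\|^2\|u_*\|^2}.$$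 The quantity $\xi_t$ is the one for which the method's contraction estimate reads $\operatorname{dist}^2(x_{t+1},x_* )\le(1-\xi_t)\operatorname{dist}^2(x_t,x_* )$. *)

(* Defs.v *)
From mathcomp Require Export all_boot all_order all_algebra.
From mathcomp Require Export all_classical all_reals all_analysis.
Export Order.TTheory GRing.Theory Num.Theory.
Export numFieldNormedType.Exports.

Set Implicit Arguments.
Unset Strict Implicit.
Unset Printing Implicit Defensive.

Local Open Scope classical_set_scope.
Local Open Scope ring_scope.

Definition qform (R : realType) (n : nat) (C : 'M[R]_n) (x : 'cV[R]_n) : R :=
  (x^T *m C *m x) 0 0.

Definition spd (R : realType) (n : nat) (C : 'M[R]_n) : Prop :=
  C^T = C /\ forall x : 'cV[R]_n, x != 0 -> 0 < qform C x.

(* The symmetric positive definite square root. It exists and is unique when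
   C is symmetric positive definite; the default value 0 is used otherwise. *)
Definition sqrtmx (R : realType) (n : nat) (C : 'M[R]_n) : 'M[R]_n :=
  xget 0 [set S : 'M[R]_n | spd S /\ S *m S = C].

Definition isqrtmx (R : realType) (n : nat) (C : 'M[R]_n) : 'M[R]_n :=
  invmx (sqrtmx C).

(* The library norm `|x| on matrices is the max norm, so the Euclidean norm is
   defined separately. *)
Definition dotc (R : realType) (n : nat) (x y : 'cV[R]_n) : R :=
  (x^T *m y) 0 0.

Definition enorm (R : realType) (n : nat) (x : 'cV[R]_n) : R :=
  Num.sqrt (dotc x x).

Definition cnorm (R : realType) (n : nat) (C : 'M[R]_n) (x : 'cV[R]_n) : R :=
  Num.sqrt (qform C x).

Definition sphere (R : realType) (n : nat) : set 'cV[R]_n :=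
  [set x | enorm x = 1].
Arguments sphere : clear implicits.

Definition sdist (R : realType) (n : nat) (x y : 'cV[R]_n) : R :=
  acos (dotc x y).

Definition egrad (R : realType) (n : nat) (f : 'cV[R]_n -> R) (x : 'cV[R]_n) :
    'cV[R]_n :=
  \col_i 'D_(delta_mx i 0) f x.

Definition sgrad (R : realType) (n : nat) (f : 'cV[R]_n -> R) (x : 'cV[R]_n) :
    'cV[R]_n :=
  (1%:M - x *m x^T) *m egrad f x.

(* exp_x(v); only meant for v orthogonal to x. *)
Definition sexp (R : realType) (n : nat) (x v : 'cV[R]_n) : 'cV[R]_n :=
  if v == 0 then x
  else cos (enorm v) *: x + (sin (enorm v) / enorm v) *: v.

(* lam lists all eigenvalues of A, with multiplicity, in nondecreasing order. *)
Definition is_eigenvalues (R : realType) (n : nat) (A : 'M[R]_n)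
    (lam : 'I_n -> R) : Prop :=
  char_poly A = \prod_(i < n) ('X - (lam i)%:P)
  /\ forall i j : 'I_n, (i <= j)%N -> lam i <= lam j.

Section Objects.
Variables (R : realType) (n : nat) (A B : 'M[R]_n).

Definition rayleigh (x : 'cV[R]_n) : R :=
  - (qform (invmx B) x / qform (isqrtmx B *m A *m isqrtmx B) x).

Definition xstar (u : 'cV[R]_n) : 'cV[R]_n :=
  (enorm (sqrtmx B *m u))^-1 *: (sqrtmx B *m u).

Definition dangle (u : 'cV[R]_n) : R :=
  asin (enorm u ^+ 2 / (cnorm B u * cnorm (invmx B) u)).

Definition hnorm (x : 'cV[R]_n) : R := enorm (sqrtmx A *m isqrtmx B *m x).

(* In gammaf, muf and af the scalars l1, l2, ln stand for the first, second
   and last eigenvalues of A, and u for the eigenvector u_*. *)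
Definition gammaf (numax l1 ln : R) (x : 'cV[R]_n) : R :=
  numax * (l1^-1 - ln^-1) / hnorm x ^+ 2.

Definition muf (numin l1 l2 : R) (u x : 'cV[R]_n) : R :=
  8 * numin * (l1^-1 - l2^-1) * cnorm B u
  / (pi ^+ 2 * hnorm x * cnorm A u).

Definition af (l1 : R) (u x : 'cV[R]_n) : R :=
  l1 * cnorm (invmx B) u ^+ 2 * (cos (sdist x (xstar u)) - cos (dangle u))
  / (hnorm x ^+ 2 * enorm u ^+ 2).

End Objects.

(* Main.v *)
Require Import Defs.
From mathcomp Require Import ring lra perm.
From mathcomp Require Import complex.

(* Write w = B^{-1/2} x, q = w^T A w, D = f(x) - f(x_star) = 1/l1 - w^T w / q,
   d = 1/l1 - 1/ln, c = x^T x_star, g = grad f(x) and s = eta |g|. Two estimates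
   drive the proof:
   - -<g, x_star> >= 2 a D, by Cauchy-Schwarz applied to x and the component of
     x_star orthogonal to B^{-1/2} u;
   - |g|^2 <= 4 gamma D (1 - D / d), a Bhatia-Davis variance inequality.
   The step eta = a / gamma then gives, with P = 2 eta a D, both
   <-eta g, x_star> >= P and s^2 <= 2 (1 - D / d) P, and Cauchy-Schwarz gives
   s / 2 <= sin(dist(x, x_star)). Hence c increases by at least a multiple of
   P D / d >= const * D^2. As D dominates 1 - c^2, the iterates converge to
   x_star, where xi is continuous. *)

Set Implicit Arguments.
Unset Strict Implicit.
Unset Printing Implicit Defensive.

Local Open Scope classical_set_scope.
Local Open Scope ring_scope.

(** * The Euclidean product and the real spectral theorem *)

Section Dot.
Variables (R : realType) (n : nat).
Implicit Types (x y z : 'cV[R]_n) (M C : 'M[R]_n).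

Lemma dotcE x y : dotc x y = \sum_i x i 0 * y i 0.
Proof. by rewrite /dotc mxE; apply: eq_bigr => i _; rewrite mxE. Qed.

Lemma dotcC x y : dotc x y = dotc y x.
Proof. by rewrite !dotcE; apply: eq_bigr => i _; rewrite mulrC. Qed.

Lemma dotcDl x y z : dotc (x + y) z = dotc x z + dotc y z.
Proof. by rewrite !dotcE -big_split; apply: eq_bigr => i _; rewrite mxE mulrDl. Qed.

Lemma dotcZl (k : R) x y : dotc (k *: x) y = k * dotc x y.
Proof. by rewrite !dotcE mulr_sumr; apply: eq_bigr => i _; rewrite mxE mulrA. Qed.

Lemma dotcNl x y : dotc (- x) y = - dotc x y.
Proof. by rewrite -scaleN1r dotcZl mulN1r. Qed.

Lemma dotcDr x y z : dotc x (y + z) = dotc x y + dotc x z.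
Proof. by rewrite dotcC dotcDl !(dotcC x). Qed.

Lemma dotcZr (k : R) x y : dotc x (k *: y) = k * dotc x y.
Proof. by rewrite dotcC dotcZl dotcC. Qed.

Lemma dotcNr x y : dotc x (- y) = - dotc x y.
Proof. by rewrite dotcC dotcNl dotcC. Qed.

Definition dotcP := (dotcDl, dotcDr, dotcNl, dotcNr, dotcZl, dotcZr).

Lemma dotc_mull M x y : dotc (M *m x) y = dotc x (M^T *m y).
Proof. by rewrite /dotc trmx_mul mulmxA. Qed.

Lemma qformE C x : qform C x = dotc x (C *m x).
Proof. by rewrite /dotc /qform mulmxA. Qed.

Lemma dotc_ge0 x : 0 <= dotc x x.
Proof. by rewrite dotcE sumr_ge0// => i _; rewrite -expr2 sqr_ge0. Qed.

Lemma dotc_eq0 x : (dotc x x == 0) = (x == 0).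
Proof.
apply/idP/eqP => [|->]; last by rewrite dotcE big1// => i _; rewrite mxE mul0r.
rewrite dotcE psumr_eq0 => [/allP h|i _]; last by rewrite -expr2 sqr_ge0.
apply/colP => i; rewrite mxE; have /= := h i (mem_index_enum i).
by rewrite mulf_eq0 orbb => /eqP.
Qed.

Lemma dotc_gt0 x : x != 0 -> 0 < dotc x x.
Proof. by move=> x0; rewrite lt_def dotc_eq0 x0 dotc_ge0. Qed.

Lemma enormE x : enorm x ^+ 2 = dotc x x.
Proof. by rewrite sqr_sqrtr ?dotc_ge0. Qed.

(** The polynomial [t -> qform C (x + t *: y)] never becomes negative, so its discriminant is at
    most 0. Semidefiniteness allows its leading coefficient to vanish, hence the case split. *)
Lemma psd_CauchySchwarz C x y : C^T = C -> (forall z, 0 <= qform C z) ->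
  dotc x (C *m y) ^+ 2 <= qform C x * qform C y.
Proof.
move=> Cs Cp.
have sy : dotc y (C *m x) = dotc x (C *m y) by rewrite dotcC dotc_mull Cs.
have key (t : R) : 0 <= qform C x + 2 * t * dotc x (C *m y) + t ^+ 2 * qform C y.
  have := Cp (x + t *: y); rewrite !qformE mulmxDr -scalemxAr !dotcP sy.
  by congr (_ <= _); ring.
have := Cp y; rewrite le_eqVlt => /predU1P[y0|y0].
  have [->|b0] := eqVneq (dotc x (C *m y)) 0; first by rewrite expr0n/= mulr_ge0.
  (* With [qform C y] equal to 0 the polynomial is affine in t, and this t would give it the value
     -1. *)
  have := key (- (qform C x + 1) / (2 * dotc x (C *m y))).
  rewrite -y0 mulr0 addr0 (_ : _ + _ = -1) ?ler0N1//; by field.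
(* This t is the minimiser of the polynomial. *)
have := key (- dotc x (C *m y) / qform C y).
rewrite (_ : _ + _ = (qform C x * qform C y - dotc x (C *m y) ^+ 2) / qform C y).
  by rewrite pmulr_lge0 ?invr_gt0// subr_ge0.
by field; rewrite gt_eqF.
Qed.

Lemma CauchySchwarz x y : dotc x y ^+ 2 <= dotc x x * dotc y y.
Proof.
have := @psd_CauchySchwarz 1%:M x y (trmx1 _ _).
rewrite !qformE !mul1mx; apply=> z; rewrite qformE mul1mx; exact: dotc_ge0.
Qed.

Lemma spd_ge0 C x : spd C -> 0 <= qform C x.
Proof.
move=> [_ h]; have [->|/h/ltW//] := eqVneq x 0.
by rewrite qformE dotcE big1 // => i _; rewrite mxE mul0r.
Qed.

Lemma spd_unit C : spd C -> C \in unitmx.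
Proof.
move=> [Cs h]; rewrite -row_free_unit; apply/inj_row_free => v vC.
apply/eqP; apply/contraT => v0.
have := h v^T; rewrite -(inj_eq trmx_inj) trmxK trmx0 => /(_ v0).
by rewrite /qform trmxK vC mul0mx mxE ltxx.
Qed.

End Dot.

(** * Orthogonal diagonalisation of real symmetric matrices *)

Section Spectral.
Variable R : realType.

(** The complexified matrix has an eigenvector x + iy, with eigenvalue a. Symmetry of A forces Im a
    * (|x|^2 + |y|^2) = 0, so a is real, and whichever of x and y is nonzero is a real
    eigenvector. *)
Lemma sym_eigenvector n (A : 'M[R]_n.+1) : A^T = A ->
  exists l (v : 'cV[R]_n.+1), v != 0 /\ A *m v = l *: v.
Proof.
move=> As; pose AC := map_mx (real_complex R) A.
have [a /eigenvalueP[v vA v0]] := @eigenvalue_closed _ _ AC (ltn0Sn n).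
pose x : 'cV[R]_n.+1 := \col_i complex.Re (v 0 i).
pose y : 'cV[R]_n.+1 := \col_i complex.Im (v 0 i).
have Ax : A *m x = complex.Re a *: x - complex.Im a *: y.
  apply/colP => i; have /rowP/(_ i) := vA; rewrite !mxE.
  move=> /(congr1 (@complex.Re R)); rewrite raddf_sum/= => h.
  transitivity (complex.Re (a * v 0 i)); last by case: (a) (v 0 i) => ? ? [].
  rewrite -h; apply: eq_bigr => k _; rewrite !mxE -{1}As mxE.
  by case: (v 0 k) => p q /=; rewrite mulr0 subr0 mulrC.
have Ay : A *m y = complex.Im a *: x + complex.Re a *: y.
  apply/colP => i; have /rowP/(_ i) := vA; rewrite !mxE.
  move=> /(congr1 (@complex.Im R)); rewrite raddf_sum/= => h.
  transitivity (complex.Im (a * v 0 i)).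
    rewrite -h; apply: eq_bigr => k _; rewrite !mxE -{1}As mxE.
    by case: (v 0 k) => p q /=; rewrite mulr0 add0r mulrC.
  by case: (a) (v 0 i) => ? ? [] /= *; rewrite addrC.
have xy0 : (x != 0) || (y != 0).
  apply: contraNT v0; rewrite negb_or !negbK => /andP[/eqP x0 /eqP y0].
  apply/eqP/rowP => i; move/colP: x0 => /(_ i); move/colP: y0 => /(_ i).
  by rewrite !mxE; case: (v 0 i) => ? ? /= -> ->.
have b0 : complex.Im a = 0.
  have : dotc (A *m x) y = dotc x (A *m y) by rewrite dotc_mull As.
  rewrite Ax Ay !dotcP => h.
  have /eqP : complex.Im a * (dotc x x + dotc y y) = 0 by lra.
  rewrite mulf_eq0 => /predU1P[//|]; rewrite paddr_eq0 ?dotc_ge0// !dotc_eq0.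
  by move: xy0; case: (x == 0); case: (y == 0).
case/orP: xy0 => h; [exists (complex.Re a), x|exists (complex.Re a), y]; split=> //.
  by rewrite Ax b0 scale0r subr0.
by rewrite Ay b0 scale0r add0r.
Qed.

(** The reflection along v - e exchanges two unit vectors. It serves to move an eigenvector onto the
    first basis vector in the spectral theorem. *)
Lemma householder n (e v : 'cV[R]_n) : dotc e e = 1 -> dotc v v = 1 ->
  exists H : 'M[R]_n, [/\ H^T = H, H *m H = 1%:M & H *m e = v].
Proof.
move=> e1 v1; have [->|ve] := eqVneq v e.
  by exists 1%:M; rewrite trmx1 !mul1mx.
have [w wE] : exists w, w = v - e by exists (v - e).
have w0 : dotc w w != 0 by rewrite wE dotc_eq0 subr_eq0.
have mulw z : w *m w^T *m z = dotc w z *: w.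
  by rewrite -mulmxA [w^T *m z]mx11_scalar mul_mx_scalar.
exists (1%:M - (2 / dotc w w) *: (w *m w^T)); split.
- by rewrite linearB linearZ/= trmx1 trmx_mul trmxK.
- rewrite mulmxBr mulmx1 mulmxBl mul1mx -scalemxAr -scalemxAl !mulmxA mulw.
  rewrite -scalemxAl !scalerA.
  set k := 2 / dotc w w; rewrite (_ : _ * dotc w w = k + k); last by rewrite /k; field.
  by rewrite scalerDl opprB addrK subrK.
- rewrite mulmxBl mul1mx -scalemxAl mulw scalerA.
  have ww : dotc w w = -2 * dotc w e.
    by rewrite wE !dotcP e1 v1 (dotcC e v); ring.
  have we0 : dotc w e != 0 by move: w0; rewrite ww mulf_eq0 negb_or => /andP[].
  have -> : 2 / dotc w w * dotc w e = -1 by rewrite ww; field.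
  by rewrite scaleN1r opprK wE addrC subrK.
Qed.

(** Deflation, by induction on the dimension: conjugating by the reflection that takes e to a unit
    eigenvector splits off a 1 x 1 block and leaves a smaller symmetric block. *)
Lemma sym_spectral n (A : 'M[R]_n) : A^T = A ->
  exists (P : 'M[R]_n) (d : 'rV[R]_n), P^T *m P = 1%:M /\ A = P *m diag_mx d *m P^T.
Proof.
elim: n A => [|n IHn] A.
  by move=> _; exists 1%:M, 0; split; rewrite [LHS]flatmx0 ?[RHS]flatmx0.
rewrite -[n.+1]/(1 + n)%N in A * => As.
have [l [v0 [v00 Av0]]] := sym_eigenvector As.
pose v := (Num.sqrt (dotc v0 v0))^-1 *: v0.
have v1 : dotc v v = 1.
  rewrite !dotcP mulrA -expr2 exprVn sqr_sqrtr ?dotc_ge0// mulVf//.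
  by rewrite dotc_eq0.
have Av : A *m v = l *: v by rewrite -scalemxAr Av0 !scalerA mulrC.
pose e : 'cV[R]_(1 + n) := col_mx 1 0.
have e1 : dotc e e = 1.
  by rewrite /dotc tr_col_mx mul_row_col trmx1 trmx0 mul1mx mul0mx addr0 mxE.
have [H [Hs HH He]] := householder e1 v1.
pose A1 : 'M[R]_(1 + n) := H *m A *m H.
have A1s : A1^T = A1 by rewrite /A1 !trmx_mul Hs As mulmxA.
have A1e : A1 *m e = l *: e.
  by rewrite /A1 -!mulmxA He Av -scalemxAr -He mulmxA HH mul1mx.
(* As e is an eigenvector, the first column of [A1] is l e; symmetry then clears the rest of the
   first row. *)
have A1E : A1 = block_mx l%:M 0 0 (drsubmx A1).
  have [ul dl] : ulsubmx A1 = l%:M /\ dlsubmx A1 = 0.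
    move: A1e; rewrite -{1}[A1]submxK mul_block_col !mulmx1 !mulmx0 !addr0.
    by rewrite scale_col_mx scaler0 scalemx1 => /eq_col_mx.
  by rewrite -[LHS]submxK -{2}A1s -trmx_dlsub dl ul trmx0.
have A2s : (drsubmx A1)^T = drsubmx A1 by rewrite trmx_drsub A1s.
have [Q [d [Q1 A2]]] := IHn _ A2s.
pose P0 : 'M[R]_(1 + n) := block_mx 1%:M 0 0 Q.
exists (H *m P0), (row_mx l%:M d); split.
  rewrite trmx_mul Hs -mulmxA (mulmxA H) HH mul1mx.
  rewrite /P0 tr_block_mx mulmx_block !trmx1 !trmx0 !mulmx1 !mulmx0.
  by rewrite !mul0mx !addr0 add0r Q1 -scalar_mx_block.
rewrite trmx_mul Hs !mulmxA.
have -> : A = H *m A1 *m H by rewrite /A1 !mulmxA HH mul1mx -mulmxA HH mulmx1.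
congr (_ *m _); rewrite -!mulmxA; congr (_ *m _).
rewrite A1E {1}A2 /P0 tr_block_mx diag_mx_row !mulmx_block.
rewrite trmx1 !trmx0 !mulmx0 !mul0mx !addr0 ?add0r !mul1mx !mulmx1 -?mulmxA.
congr block_mx; first by apply/matrixP => i j; rewrite !mxE !ord1 !eqxx !mulr1n.
by rewrite mulmx0.
Qed.

Lemma diag_conj_eigenvalues n (A P : 'M[R]_n) (d : 'rV[R]_n) :
  P^T *m P = 1%:M -> A = P *m diag_mx d *m P^T ->
  char_poly A = \prod_(i < n) ('X - (d 0 i)%:P).
Proof.
move=> PP ->; have PP' : P *m P^T = 1%:M by apply: mulmx1C.
transitivity (char_poly (diag_mx d)).
  rewrite /char_poly; pose p := map_mx (@polyC R) P.
  have pp' : p *m p^T = 1%:M by rewrite /p map_trmx -map_mxM PP' map_mx1.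
  have -> : char_poly_mx (P *m diag_mx d *m P^T) =
      p *m char_poly_mx (diag_mx d) *m p^T.
    rewrite /char_poly_mx mulmxBr mulmxBl !map_mxM -map_trmx -/p; congr (_ - _).
    by rewrite scalar_mxC -mulmxA pp' mulmx1.
  by rewrite !det_mulmx mulrAC -det_mulmx pp' det1 mul1r.
rewrite char_poly_trig ?diag_mx_is_trig//.
by apply: eq_bigr => i _; rewrite mxE eqxx mulr1n.
Qed.

(** Equal products of linear factors have the same roots up to a permutation. Permuting the columns
    of P accordingly puts the eigenvalues in the order prescribed by [lam]. *)
Lemma spectral_eigenvalues n (A : 'M[R]_n) (lam : 'I_n -> R) :
  A^T = A -> char_poly A = \prod_(i < n) ('X - (lam i)%:P) ->
  exists P : 'M[R]_n, P^T *m P = 1%:M /\ A = P *m diag_mx (\row_i lam i) *m P^T.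
Proof.
move=> As; have [P [d [PP AE]]] := sym_spectral As.
rewrite (diag_conj_eigenvalues PP AE) => h.
have : perm_eq [tuple lam i | i < n] [tuple d 0 i | i < n].
  by apply: prod_XsubC_eq; rewrite !big_map -!enumT !big_enum/= h.
move=> /tuple_permP[s sE].
have ls i : lam i = d 0 (s i).
  have := congr1 (fun t : seq R => nth 0 t i) sE.
  by rewrite -!tnth_nth !tnth_mktuple.
exists (\matrix_(i, j) P i (s j)); split.
  apply/matrixP => i j; have /matrixP/(_ (s i) (s j)) := PP.
  rewrite !mxE (inj_eq perm_inj) => <-.
  by apply: eq_bigr => k _; rewrite !mxE.
rewrite AE; apply/matrixP => i j; rewrite !mxE (reindex_inj (@perm_inj _ s)).
apply: eq_bigr => k _; rewrite !mul_mx_diag !mxE -ls.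
by [].
Qed.

End Spectral.

Section SpectralForms.
Variables (R : realType) (n : nat) (P : 'M[R]_n).
Hypothesis PP : P^T *m P = 1%:M.

Lemma qform_conj_diag (d : 'rV[R]_n) x :
  qform (P *m diag_mx d *m P^T) x = \sum_i d 0 i * (P^T *m x) i 0 ^+ 2.
Proof.
rewrite qformE -!mulmxA -[P in LHS]trmxK -dotc_mull dotcE; apply: eq_bigr => i _.
by rewrite mul_diag_mx [in X in _ * X]mxE trmxK; ring.
Qed.

Lemma dotc_conj x : dotc x x = \sum_i (P^T *m x) i 0 ^+ 2.
Proof.
have := qform_conj_diag (const_mx 1) x.
rewrite diag_const_mx mulmx1 (mulmx1C PP) qformE mul1mx => ->.
by apply: eq_bigr => i _; rewrite mxE mul1r.
Qed.

Lemma spd_conj_diag (d : 'rV[R]_n) :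
  spd (P *m diag_mx d *m P^T) <-> forall i, 0 < d 0 i.
Proof.
split=> [[_ h] i|d0].
  have Pi : P^T *m (P *m delta_mx i 0) = delta_mx i (0 : 'I_1).
    by rewrite mulmxA PP mul1mx.
  have /h : P *m delta_mx i (0 : 'I_1) != 0.
    apply: contraTneq isT => P0; move: Pi; rewrite P0 mulmx0.
    by move/matrixP/(_ i 0)/eqP; rewrite !mxE !eqxx eq_sym oner_eq0.
  rewrite qform_conj_diag Pi (bigD1 i)//= big1 => [|j ji].
    by rewrite !mxE !eqxx expr1n mulr1 addr0.
  by rewrite !mxE (negbTE ji) expr0n mulr0.
split=> [|x x0]; first by rewrite !trmx_mul trmxK tr_diag_mx mulmxA.
have := dotc_gt0 x0; rewrite dotc_conj qform_conj_diag => h.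
rewrite lt_def sumr_ge0 ?andbT => [|i _]; last by rewrite mulr_ge0 ?sqr_ge0// ltW.
apply: contraTneq h => /eqP; rewrite psumr_eq0 => [/allP h|i _]; last first.
  by rewrite mulr_ge0 ?sqr_ge0// ltW.
rewrite big1 ?ltxx// => i _; have := h i (mem_index_enum i).
by rewrite /= mulf_eq0 gt_eqF//= => /eqP.
Qed.

Lemma invmx_conj_diag (d : 'rV[R]_n) : (forall i, d 0 i != 0) ->
  invmx (P *m diag_mx d *m P^T) = P *m diag_mx (\row_i (d 0 i)^-1) *m P^T.
Proof.
move=> d0; set M := (X in invmx X); set N := (RHS).
have MN : M *m N = 1%:M.
  rewrite /M /N !mulmxA -[_ *m P^T *m P]mulmxA PP mulmx1 -[P *m _ *m _]mulmxA.
  rewrite mulmx_diag (_ : (\row__ _) = const_mx 1).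
    by rewrite diag_const_mx mulmx1 (mulmx1C PP).
  by apply/rowP => i; rewrite !mxE divff.
have [Mu _] := mulmx1_unit MN.
by apply: (can_inj (mulKmx Mu)); rewrite mulmxV.
Qed.

End SpectralForms.

(** [xget] returns a square root as soon as one exists, and one is obtained by taking square roots
    of the eigenvalues. *)
Lemma sqrtmxP (R : realType) n (C : 'M[R]_n) : spd C ->
  spd (sqrtmx C) /\ sqrtmx C *m sqrtmx C = C.
Proof.
move=> Cp; rewrite /sqrtmx.
suff : exists S : 'M[R]_n, spd S /\ S *m S = C.
  by move=> e; case: xgetP => [S _ //|/(_ (projT1 (cid e)))]; case: (cid e).
have [P [d [PP CE]]] := sym_spectral (proj1 Cp).
have d0 : forall i, 0 < d 0 i by apply/(spd_conj_diag PP); rewrite -CE.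
exists (P *m diag_mx (\row_i Num.sqrt (d 0 i)) *m P^T); split.
  by apply/(spd_conj_diag PP) => i; rewrite mxE sqrtr_gt0.
rewrite !mulmxA -[_ *m P^T *m P]mulmxA PP mulmx1 -[P *m _ *m _]mulmxA mulmx_diag CE.
congr (_ *m diag_mx _ *m _); apply/rowP => i.
by rewrite !mxE -expr2 sqr_sqrtr// ltW.
Qed.

(** * Bounds on quadratic forms from the ordered spectrum *)

Section Eigenvalues.
Variables (R : realType) (m : nat) (A : 'M[R]_m.+2) (lam : 'I_m.+2 -> R).
Hypotheses (hA : spd A) (hlam : is_eigenvalues A lam).

Lemma eigenvalues_gt0 i : 0 < lam i.
Proof.
have [P [PP AE]] := spectral_eigenvalues hA.1 hlam.1.
have /(spd_conj_diag PP)/(_ i) : spd (P *m diag_mx (\row_i lam i) *m P^T).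
  by rewrite -AE.
by rewrite mxE.
Qed.

Lemma qform_ge_min w : lam ord0 * dotc w w <= qform A w.
Proof.
have [P [PP AE]] := spectral_eigenvalues hA.1 hlam.1.
rewrite AE qform_conj_diag (dotc_conj PP) mulr_sumr ler_sum// => i _.
by rewrite mxE ler_wpM2r ?sqr_ge0// hlam.2.
Qed.

Lemma qform_le_max w : qform A w <= lam ord_max * dotc w w.
Proof.
have [P [PP AE]] := spectral_eigenvalues hA.1 hlam.1.
rewrite AE qform_conj_diag (dotc_conj PP) mulr_sumr ler_sum// => i _.
by rewrite mxE ler_wpM2r ?sqr_ge0// hlam.2 ?leq_ord.
Qed.

(* Bhatia-Davis inequality for the spectral measure of w. *)
Lemma qform_invmx_le w :
  qform (invmx A) w <= ((lam ord0)^-1 + (lam ord_max)^-1) * dotc w w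
    - (lam ord0)^-1 * (lam ord_max)^-1 * qform A w.
Proof.
have [P [PP AE]] := spectral_eigenvalues hA.1 hlam.1.
have l0 := eigenvalues_gt0.
rewrite {1}AE invmx_conj_diag => [|//|i]; last by rewrite mxE gt_eqF.
rewrite qform_conj_diag AE qform_conj_diag (dotc_conj PP) !mulr_sumr -sumrB.
apply: ler_sum => i _; set y := (P^T *m w) i 0; rewrite !mxE.
suff h : (lam i)^-1 <= (lam ord0)^-1 + (lam ord_max)^-1
    - (lam ord0)^-1 * (lam ord_max)^-1 * lam i.
  have := ler_wpM2r (sqr_ge0 y) h; congr (_ <= _); ring.
have h1 : (lam i)^-1 <= (lam ord0)^-1 by rewrite lef_pV2 ?posrE// hlam.2.
have h2 : (lam ord_max)^-1 <= (lam i)^-1.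
  by rewrite lef_pV2 ?posrE// hlam.2 ?leq_ord.
rewrite -subr_ge0; set a := (lam ord0)^-1; set b := (lam ord_max)^-1.
(* For each eigenvalue, its inverse lies between b and a, so the product of its distances to both
   ends is nonnegative. *)
rewrite (_ : _ - _ = (a - (lam i)^-1) * ((lam i)^-1 - b) * lam i).
  by rewrite !mulr_ge0 ?subr_ge0// ltW.
by field; rewrite gt_eqF.
Qed.

(** Because the first eigenvalue is simple, u has only its first coordinate nonzero in the
    eigenbasis. Orthogonality to u therefore kills the first coordinate of w, and only eigenvalues
    from the second on contribute. *)
Lemma qform_ge_second u w : lam ord0 < lam (inord 1) ->
  u != 0 -> A *m u = lam ord0 *: u -> dotc u w = 0 ->
  lam (inord 1) * dotc w w <= qform A w.
Proof.
move=> l12 u0 Au uw.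
have [P [PP AE]] := spectral_eigenvalues hA.1 hlam.1.
have lge i : i != ord0 -> lam (inord 1) <= lam i.
  move=> i0; apply: hlam.2; rewrite inordK//.
  by rewrite lt0n; apply: contra i0 => /eqP i0; apply/eqP/val_inj.
pose z := P^T *m u.
have z0 i : i != ord0 -> z i 0 = 0.
  move=> i0; have : P^T *m (A *m u) = lam ord0 *: z by rewrite Au -scalemxAr.
  rewrite AE !mulmxA PP mul1mx -mulmxA -/z mul_diag_mx => /matrixP/(_ i 0).
  rewrite !mxE => /eqP; rewrite -subr_eq0 -mulrBl mulf_eq0 subr_eq0.
  by rewrite gt_eqF ?(lt_le_trans l12 (lge i i0))// => /eqP.
have z00 : z ord0 0 != 0.
  apply: contraNneq u0 => h; rewrite -dotc_eq0 (dotc_conj PP) big1// => i _.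
  by rewrite -/z; have [->|/z0->] := eqVneq i ord0; rewrite ?h expr0n.
have w0 : (P^T *m w) ord0 0 = 0.
  have : dotc z (P^T *m w) = 0.
    by rewrite dotc_mull trmxK mulmxA (mulmx1C PP) mul1mx.
  rewrite dotcE (bigD1 ord0)//= big1 => [|i /z0->]; last by rewrite mul0r.
  by move/eqP; rewrite addr0 mulf_eq0 (negbTE z00) => /eqP.
rewrite AE qform_conj_diag (dotc_conj PP) mulr_sumr ler_sum// => i _.
rewrite mxE; have [->|/lge h] := eqVneq i ord0; first by rewrite w0 expr0n !mulr0.
by rewrite ler_wpM2r ?sqr_ge0.
Qed.

End Eigenvalues.

(** * Trigonometric estimate and gradient of a quotient of quadratic forms *)

Section Trig.
Variable R : realType.
Implicit Types x s : R.

Lemma sin_le_id x : 0 <= x -> sin x <= x.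
Proof.
move=> x0; have cs : {within `[0, x], continuous (@sin R)}.
  by apply: continuous_subspaceT => y; exact: continuous_sin.
have [y _] := MVT_segment x0 (fun y _ => is_derive_sin y) cs.
by rewrite sin0 !subr0 => ->; rewrite ler_piMl// cos_le1.
Qed.

Lemma cos_ge_cos1 x : 0 <= x <= 1 -> cos 1 <= cos x.
Proof.
move=> /andP[x0 x1]; have p1 : 1 <= pi :> R by rewrite (le_trans _ (pi_ge2 R)) ?ler1n.
have [->|x1'] := eqVneq x 1; first by [].
by rewrite ltW// ltr_cos ?in_itv/= ?ler01 ?x0 ?p1 ?(le_trans x1)// lt_neqAle x1' x1.
Qed.

Lemma sin_ge_cos1_mul x : 0 <= x <= 1 -> cos 1 * x <= sin x.
Proof.
move=> /andP[x0 x1]; have cs : {within `[0, x], continuous (@sin R)}.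
  by apply: continuous_subspaceT => y; exact: continuous_sin.
have [y] := MVT_segment x0 (fun y _ => is_derive_sin y) cs.
rewrite in_itv/= => /andP[y0 yx]; rewrite sin0 !subr0 => ->.
by rewrite ler_wpM2r// cos_ge_cos1// y0 (le_trans yx).
Qed.

(* With t = s / 2, the claim reads (sin t cos t / t) E - 2 c sin^2 t >=
   cos^2(1) (1 - k) P, and c sin t <= t cos t because c^2 + t^2 <= 1. *)
Lemma geodesic_step_ineq (s c P E k : R) :
  0 < s -> 0 <= c -> (s / 2) ^+ 2 <= 1 - c ^+ 2 -> k <= 1 -> 0 <= P -> P <= E ->
  s ^+ 2 <= 2 * k * P ->
  c + cos 1 ^+ 2 * ((1 - k) * P) <= cos s * c + sin s / s * E.
Proof.
move=> s0 c0; set t := s / 2 => sc k1 P0 PE sP; have t0 : 0 < t by rewrite divr_gt0.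
have s2t : s = t + t by rewrite /t; field.
clearbody t; rewrite {s s0}s2t in sP *.
have t1 : t <= 1.
  have : t ^+ 2 <= 1 by move: sc (sqr_ge0 c); lra.
  by rewrite expr_le1// ltW.
have t01 : 0 <= t <= 1 by rewrite (ltW t0) t1.
have ct := cos_ge_cos1 t01; have st := sin_ge_cos1_mul t01.
have c1 := @cos1_gt0 R; have ct0 := lt_le_trans c1 ct.
have st0 : 0 < sin t by apply: lt_le_trans st; rewrite mulr_gt0.
have tw := ltW t0; have stw := ltW st0; have ctw := ltW ct0; have c1w := ltW c1.
(* After squaring, c^2 <= 1 - t^2 reduces this to sin^2 t <= t^2. *)
have key : c * sin t <= t * cos t.
  rewrite -(@ler_pXn2r _ 2)// ?nnegrE ?mulr_ge0//.
  rewrite !exprMn cos2sin2.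
  have : sin t ^+ 2 <= t ^+ 2.
    by rewrite ler_pXn2r ?nnegrE ?sin_le_id.
  have : c ^+ 2 * sin t ^+ 2 <= (1 - t ^+ 2) * sin t ^+ 2.
    by rewrite ler_wpM2r ?sqr_ge0//; move: sc; lra.
  move: sc; lra.
rewrite sinD cosD.
(* [r] is sin s / s in terms of the half length; both sin t / t and cos t are at least cos 1. *)
set r := sin t * cos t / t.
have r1 : cos 1 ^+ 2 <= r.
  by rewrite /r ler_pdivlMr// expr2 mulrAC ler_pM// mulr_ge0.
have r0 : 0 <= r by apply: le_trans r1; rewrite sqr_ge0.
have -> : (sin t * cos t + cos t * sin t) / (t + t) * E = r * E.
  by rewrite /r; field; rewrite gt_eqF//= -mulr2n mulrn_eq0/= gt_eqF.
have -> : (cos t * cos t - sin t * sin t) * c = c - 2 * sin t * (c * sin t).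
  by rewrite -!expr2 cos2sin2; ring.
have h1 : 2 * sin t * (c * sin t) <= 2 * sin t * (t * cos t).
  by rewrite ler_wpM2l// mulr_ge0.
have h2 : 2 * sin t * (t * cos t) = r * (2 * t ^+ 2).
  by rewrite /r; field; rewrite gt_eqF.
have h3 : r * (2 * t ^+ 2) <= r * (k * P).
  by rewrite ler_wpM2l//; move: sP; lra.
have h4 : cos 1 ^+ 2 * ((1 - k) * P) <= r * ((1 - k) * P).
  by rewrite ler_wpM2r// mulr_ge0// subr_ge0.
have h5 : r * P <= r * E by rewrite ler_wpM2l.
lra.
Qed.

End Trig.

(** * Riemannian gradient of a quotient of quadratic forms *)

Section Gradient.
Variables (R : realType) (n : nat) (M N : 'M[R]_n).
Hypotheses (Ms : M^T = M) (Ns : N^T = N).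

Lemma qform_line C (x v : 'cV[R]_n) (h : R) : C^T = C ->
  qform C (h *: v + x) = qform C x + h * (2 * dotc v (C *m x)) + h ^+ 2 * qform C v.
Proof.
move=> Cs; rewrite !qformE mulmxDr -scalemxAr !dotcP.
have -> : dotc x (C *m v) = dotc v (C *m x) by rewrite dotcC dotc_mull Cs.
ring.
Qed.

Lemma derive_quotient_qform (x v : 'cV[R]_n) : qform M x != 0 ->
  'D_v (fun y => - (qform N y / qform M y)) x =
  dotc v ((- (2 / qform M x)) *: (N *m x - (qform N x / qform M x) *: (M *m x))).
Proof.
move=> q0; rewrite /derive; apply/cvg_lim => //.
set q := qform M x in q0 *; set p := qform N x.
set p1 := 2 * dotc v (N *m x); set q1 := 2 * dotc v (M *m x).
set p2 := qform N v; set q2 := qform M v.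
pose den (h : R) := q + h * q1 + h ^+ 2 * q2.
have cid0 : (h @[h --> (0 : R)^']) --> (0 : R).
  by apply: cvg_within_filter; exact: cvg_id.
have cden : den h @[h --> (0 : R)^'] --> q.
  rewrite (_ : q = q + 0 * q1 + 0 ^+ 2 * q2); last by rewrite expr0n/= !mul0r !addr0.
  apply: cvgD; first by apply: cvgD; [exact: cvg_cst|apply: cvgM => //; exact: cvg_cst].
  by apply: cvgM; [rewrite !expr2; apply: cvgM|exact: cvg_cst].
(* This is the difference quotient in closed form, with the factor h cancelled, so that its limit is
   its value at h = 0. *)
have c1 : (p * q1 - p1 * q + h * (p * q2 - p2 * q)) / (q * den h) @[h --> (0 : R)^']
    --> (p * q1 - p1 * q + 0 * (p * q2 - p2 * q)) / (q * q).
  apply: cvgM.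
    by apply: cvgD; [exact: cvg_cst|apply: cvgM => //; exact: cvg_cst].
  by apply: cvgV; [rewrite mulf_neq0|apply: cvgM => //; exact: cvg_cst].
suff -> : dotc v (- (2 / q) *: (N *m x - p / q *: (M *m x))) =
    (p * q1 - p1 * q + 0 * (p * q2 - p2 * q)) / (q * q).
  apply: cvg_trans c1; apply: near_eq_cvg; near=> h.
  have h0 : h != 0 by near: h; exact: nbhs_dnbhs_neq.
  have d0 : den h != 0 by near: h; move/cvgr_neq0 : cden; exact.
  rewrite /= !qform_line// -/p -/q -/p1 -/q1 -/p2 -/q2 -/(den h).
  rewrite /GRing.scale/=.
  by move: d0; rewrite /den => d0; field; rewrite d0 h0 q0.
by rewrite !dotcP /p1 /q1; field.
Unshelve. all: by end_near. Qed.

Lemma egrad_quotient_qform (x : 'cV[R]_n) : qform M x != 0 ->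
  egrad (fun y => - (qform N y / qform M y)) x =
  (- (2 / qform M x)) *: (N *m x - (qform N x / qform M x) *: (M *m x)).
Proof.
move=> q0; apply/colP => i; rewrite mxE derive_quotient_qform//.
set z := (X in dotc _ X); rewrite dotcE (bigD1 i)//= big1 => [|j ji].
  by rewrite mxE !eqxx mul1r addr0.
by rewrite mxE (negbTE ji) mul0r.
Qed.

(** The quotient is homogeneous of degree 0, so its Euclidean gradient is already orthogonal to x
    and the tangential projection fixes it. *)
Lemma sgrad_quotient_qform (x : 'cV[R]_n) : qform M x != 0 ->
  sgrad (fun y => - (qform N y / qform M y)) x =
  (- (2 / qform M x)) *: (N *m x - (qform N x / qform M x) *: (M *m x)).
Proof.
move=> q0; rewrite /sgrad egrad_quotient_qform// mulmxBl mul1mx.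
set g := (X in X - _); suff xg : dotc x g = 0.
  by rewrite -mulmxA [x^T *m g]mx11_scalar [_ 0 0]xg raddf0 mulmx0 subr0.
rewrite /g !dotcP -!qformE; field; exact: q0.
Qed.

End Gradient.

(** * The geometry of [B^{1/2}] and the angle of distortion *)

Section Geometry.
Variables (R : realType) (n : nat) (A B : 'M[R]_n).
Hypotheses (hA : spd A) (hB : spd B).

Let S := sqrtmx B.
Let T := isqrtmx B.

Lemma sqrtmx_sym : S^T = S. Proof. exact: (sqrtmxP hB).1.1. Qed.

Lemma sqrtmx_isqrt : S *m T = 1%:M.
Proof. by rewrite mulmxV ?spd_unit//; apply: (sqrtmxP hB).1. Qed.

Lemma isqrtmx_sqrt : T *m S = 1%:M.
Proof. exact/mulmx1C/sqrtmx_isqrt. Qed.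

Lemma isqrtmx_sym : T^T = T.
Proof. by rewrite /T /isqrtmx trmx_inv sqrtmx_sym. Qed.

Lemma isqrtmx_sqr : T *m T = invmx B.
Proof.
have Bu := spd_unit hB; apply: (can_inj (mulKmx Bu)); rewrite mulmxV//.
rewrite -(sqrtmxP hB).2 -/S !mulmxA -[S *m S *m T]mulmxA sqrtmx_isqrt mulmx1.
exact: sqrtmx_isqrt.
Qed.

Lemma invmx_sym : (invmx B)^T = invmx B.
Proof. by rewrite trmx_inv hB.1. Qed.

Lemma qform_isqrt x : qform (invmx B) x = dotc (T *m x) (T *m x).
Proof. by rewrite qformE -isqrtmx_sqr dotc_mull isqrtmx_sym mulmxA. Qed.

Lemma qform_conj x : qform (T *m A *m T) x = qform A (T *m x).
Proof. by rewrite !qformE dotc_mull isqrtmx_sym !mulmxA. Qed.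

Lemma conj_sym : (T *m A *m T)^T = T *m A *m T.
Proof. by rewrite !trmx_mul isqrtmx_sym hA.1 mulmxA. Qed.

Lemma dotc_isqrt x : dotc x x = qform B (T *m x).
Proof.
rewrite qformE -(sqrtmxP hB).2 -/S -mulmxA [S *m (T *m x)]mulmxA sqrtmx_isqrt mul1mx.
by rewrite dotc_mull isqrtmx_sym mulmxA isqrtmx_sqrt mul1mx.
Qed.

Lemma hnorm_sqr x : hnorm A B x ^+ 2 = qform A (T *m x).
Proof.
rewrite /hnorm enormE -!mulmxA dotc_mull (sqrtmxP hA).1.1 !mulmxA.
by rewrite (sqrtmxP hA).2 qformE -!mulmxA.
Qed.

Lemma cnormE C (u : 'cV[R]_n) : spd C -> cnorm C u ^+ 2 = qform C u.
Proof. by move=> hC; rewrite sqr_sqrtr// spd_ge0. Qed.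

Lemma cnorm_gt0 C (u : 'cV[R]_n) : spd C -> u != 0 -> 0 < cnorm C u.
Proof. by move=> hC u0; rewrite sqrtr_gt0 hC.2. Qed.

Lemma enorm_sqrtmx u : enorm (S *m u) = cnorm B u.
Proof.
rewrite /enorm /cnorm qformE dotc_mull sqrtmx_sym mulmxA.
by rewrite (sqrtmxP hB).2.
Qed.

Lemma spd_invmx : spd (invmx B).
Proof.
split=> [|x x0]; first exact: invmx_sym.
rewrite qform_isqrt dotc_gt0//; apply: contraNneq x0 => Tx.
by rewrite -[x]mul1mx -sqrtmx_isqrt -mulmxA Tx mulmx0.
Qed.

Lemma xstarE u : xstar B u = (cnorm B u)^-1 *: (S *m u).
Proof. by rewrite /xstar enorm_sqrtmx. Qed.

Lemma xstar_unit u : u != 0 -> dotc (xstar B u) (xstar B u) = 1.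
Proof.
move=> u0; rewrite xstarE !dotcP -enormE enorm_sqrtmx mulrA -expr2 exprVn mulVf//.
by rewrite expf_neq0// gt_eqF// cnorm_gt0.
Qed.

Lemma dotc_xstar_le1 u x : u != 0 -> dotc x x = 1 ->
  -1 <= dotc x (xstar B u) <= 1.
Proof.
move=> u0 x1; rewrite -ler_norml -(@expr_le1 _ 2)// real_normK ?num_real//.
by apply: le_trans (CauchySchwarz _ _) _; rewrite x1 xstar_unit// mulr1.
Qed.

Lemma cos_sdist u x : u != 0 -> dotc x x = 1 ->
  cos (sdist x (xstar B u)) = dotc x (xstar B u).
Proof. by move=> u0 x1; rewrite acosK// in_itv/= dotc_xstar_le1. Qed.

Definition sin_dangle u := enorm u ^+ 2 / (cnorm B u * cnorm (invmx B) u).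

(** This gives [sin_dangle] its geometric meaning: the inner product of x_star with the normalised
    B^{-1/2} u, since B^{1/2} and B^{-1/2} cancel. *)
Lemma dotc_xstar_isqrt u : u != 0 ->
  dotc (T *m u) (xstar B u) = cnorm (invmx B) u * sin_dangle u.
Proof.
move=> u0; rewrite xstarE dotcZr dotc_mull isqrtmx_sym mulmxA isqrtmx_sqrt mul1mx.
rewrite -enormE /sin_dangle; field.
by rewrite !gt_eqF ?cnorm_gt0//; exact: spd_invmx.
Qed.

Lemma sin_dangle_gt0 u : u != 0 -> 0 < sin_dangle u.
Proof.
move=> u0; rewrite divr_gt0//; first by rewrite enormE dotc_gt0.
by rewrite mulr_gt0 ?cnorm_gt0//; exact: spd_invmx.
Qed.

Lemma sin_dangle_le1 u : u != 0 -> sin_dangle u <= 1.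
Proof.
move=> u0; have iB := spd_invmx; have c0 := cnorm_gt0 iB u0.
rewrite -(@expr_le1 _ 2) ?(ltW (sin_dangle_gt0 u0))//.
have := CauchySchwarz (T *m u) (xstar B u).
rewrite dotc_xstar_isqrt// xstar_unit// mulr1 -qform_isqrt -cnormE// exprMn.
by rewrite -[leRHS]mulr1 ler_pM2l// exprn_gt0.
Qed.

Lemma cos_dangle u : u != 0 -> cos (dangle B u) = Num.sqrt (1 - sin_dangle u ^+ 2).
Proof.
move=> u0; rewrite cos_asin// sin_dangle_le1// andbT (@le_trans _ _ 0)//.
exact/ltW/sin_dangle_gt0.
Qed.

Lemma cos_dangle_sqr u : u != 0 -> cos (dangle B u) ^+ 2 = 1 - sin_dangle u ^+ 2.
Proof.
move=> u0; rewrite cos_dangle// sqr_sqrtr// subr_ge0 expr_le1// ?sin_dangle_le1//.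
exact/ltW/sin_dangle_gt0.
Qed.

Lemma cos_dangle_ge0 u : u != 0 -> 0 <= cos (dangle B u).
Proof. by move=> u0; rewrite cos_dangle// sqrtr_ge0. Qed.

(** Here the starting condition passes from angles to cosines: both angles lie in [0, pi], where cos
    is strictly decreasing. *)
Lemma sdist_lt_dangle u x : u != 0 -> dotc x x = 1 ->
  sdist x (xstar B u) < dangle B u -> cos (dangle B u) < dotc x (xstar B u).
Proof.
move=> u0 x1 h; have s1 : -1 <= sin_dangle u <= 1.
  rewrite sin_dangle_le1// andbT (@le_trans _ _ 0)//.
  exact/ltW/sin_dangle_gt0.
have [/andP[_ h2] _] := asin_def s1; have p0 := @pi_ge0 R.
rewrite -cos_sdist// ltr_cos// in_itv/=.
  by rewrite acos_ge0 ?acos_lepi// dotc_xstar_le1.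
rewrite (le_trans _ (ltW h)) ?acos_ge0 ?dotc_xstar_le1//=.
by rewrite (le_trans h2)// ler_pdivrMr// mulr_natr mulr2n lerDl.
Qed.

(* The two unit vectors xs and e = B^{-1/2}u / |u|_{B^{-1}} satisfy
   <e, xs> = sin phi, so xs - (sin phi) e has norm cos phi. *)
Lemma dotc_isqrt_ge u x : u != 0 -> dotc x x = 1 ->
  cnorm (invmx B) u * (dotc x (xstar B u) - cos (dangle B u))
    <= sin_dangle u * dotc u (T *m x).
Proof.
move=> u0 x1; have c0 := cnorm_gt0 spd_invmx u0.
set xs := xstar B u; set s := sin_dangle u; set c := cos _.
set k := cnorm (invmx B) u in c0 *.
pose e := k^-1 *: (T *m u).
have exs : dotc e xs = s.
  by rewrite dotcZl dotc_xstar_isqrt// mulrA mulVf ?mul1r// gt_eqF.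
have e1 : dotc e e = 1.
  rewrite /e !dotcP -qform_isqrt -cnormE; last exact: spd_invmx.
  by rewrite -/k; field; rewrite gt_eqF.
have ux : dotc u (T *m x) = k * dotc x e.
  rewrite /e dotcZr mulrA divff ?gt_eqF// mul1r dotcC dotc_mull.
  by rewrite isqrtmx_sym.
have : dotc xs xs = 1 by exact: xstar_unit.
clearbody e xs => xs1; have := CauchySchwarz x (xs - s *: e).
rewrite x1 mul1r !dotcP e1 (dotcC xs e) exs xs1.
rewrite (_ : 1 + _ = c ^+ 2); last by rewrite cos_dangle_sqr//; ring.
move=> h; have h2 : dotc x xs - s * dotc x e <= c.
  apply: le_trans (ler_norm _) _.
  rewrite -(@ler_pXn2r _ 2)// ?nnegrE ?cos_dangle_ge0// real_normK ?num_real//.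
  by move: h; lra.
rewrite ux mulrCA ler_pM2l//; move: h2; lra.
Qed.

End Geometry.

(** * Descent and convergence *)

(** Inversion reverses the order of forms. Cauchy-Schwarz for A, applied to y = B^{-1} r and A^{-1}
    r, bounds the square of [qform (invmx B) r] by [qform A y * qform (invmx A) r]; the hypothesis
    bounds [qform A y] by k times [qform (invmx B) r], which is then cancelled. *)
Lemma qform_invmx_antitone (R : realType) n (A B : 'M[R]_n) (k : R) :
  spd A -> spd B -> (forall x, qform A x <= k * qform B x) ->
  forall r, qform (invmx B) r <= k * qform (invmx A) r.
Proof.
move=> hA hB hAB r; set y := invmx B *m r.
have [Au Bu] := (spd_unit hA, spd_unit hB).
have By : qform (invmx B) r = qform B y.
  by rewrite !qformE /y mulKVmx// dotcC dotc_mull invmx_sym.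
have [r0|r0] := eqVneq r 0.
  have h C : qform C r = 0.
    by rewrite qformE r0 mulmx0 dotcE big1// => i _; rewrite mxE mul0r.
  by rewrite !h mulr0.
have ry : 0 < qform (invmx B) r by apply: (spd_invmx hB).2.
have Ar : qform A (invmx A *m r) = qform (invmx A) r.
  by rewrite !qformE mulKVmx// dotc_mull invmx_sym// mulmxA.
have := psd_CauchySchwarz y (invmx A *m r) hA.1 (fun z => spd_ge0 z hA).
rewrite mulKVmx// Ar.
have -> : dotc y r = qform (invmx B) r by rewrite qformE dotcC.
move=> h; have h2 : qform A y * qform (invmx A) r
    <= k * qform (invmx B) r * qform (invmx A) r.
  by rewrite By ler_wpM2r ?hAB// spd_ge0//; exact: spd_invmx.
have := le_trans h h2; rewrite expr2 mulrAC mulrC [leRHS]mulrC.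
by rewrite ler_pM2l.
Qed.

Lemma sexp_unit (R : realType) n (x v : 'cV[R]_n) : dotc x x = 1 -> dotc x v = 0 ->
  dotc (sexp x v) (sexp x v) = 1.
Proof.
move=> x1 xv; rewrite /sexp; case: eqVneq => // v0.
rewrite !dotcP x1 (dotcC v x) xv -enormE -[RHS](cos2Dsin2 (enorm v)).
by field; rewrite gt_eqF// sqrtr_gt0 dotc_gt0.
Qed.

(** The sequence is nondecreasing and bounded, hence convergent. Passing to the limit in the
    increment bound forces L^2 = 1, and the positive start excludes L = -1. *)
Lemma cvg_increments_to1 (R : realType) (c : nat -> R) (K : R) : 0 < K -> 0 < c 0%N ->
  (forall t, c t <= 1) -> (forall t, c t + K * (1 - c t ^+ 2) ^+ 2 <= c t.+1) ->
  c t @[t --> \oo] --> (1 : R).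
Proof.
move=> K0 c00 c1 cS.
have inc : {homo c : n p / (n <= p)%N >-> n <= p}.
  apply/nondecreasing_seqP => t; apply: le_trans (cS t).
  by rewrite lerDl mulr_ge0 ?sqr_ge0// ltW.
have /cvg_ex[L cL] : cvgn c.
  by apply: nondecreasing_is_cvgn => //; exists 1 => _ [t _ <-].
have L0 : 0 < L.
  have := nondecreasing_cvgn_le inc (cvgP _ cL) 0%N.
  by rewrite (cvg_lim _ cL)//; exact: lt_le_trans.
have cLS : c t.+1 @[t --> \oo] --> L by rewrite (cvg_shiftS c).
have lim1 : (c t.+1 - (c t + K * (1 - c t ^+ 2) ^+ 2)) @[t --> \oo] -->
    L - (L + K * (1 - L ^+ 2) ^+ 2).
  have c2 : (1 - c t ^+ 2) @[t --> \oo] --> 1 - L ^+ 2.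
    by apply: cvgB; [exact: cvg_cst|rewrite expr2; apply: cvgM].
  apply: cvgB => //; apply: cvgD => //; apply: cvgM; first exact: cvg_cst.
  by rewrite expr2; apply: cvgM.
have : 0 <= L - (L + K * (1 - L ^+ 2) ^+ 2).
  rewrite -(cvg_lim _ lim1)//; apply: limr_ge; first exact: cvgP lim1.
  by apply: nearW => t; rewrite subr_ge0.
rewrite opprD addrA subrr sub0r oppr_ge0 pmulr_rle0// => h.
have /eqP : (1 - L ^+ 2) ^+ 2 = 0 by apply/eqP; rewrite eq_le h sqr_ge0.
rewrite sqrf_eq0 subr_eq0 eq_sym sqrf_eq1 => /orP[/eqP <- //|/eqP LN].
by move: L0; rewrite LN ltr0N1.
Qed.

(** * Estimates for one step of the method *)

Section Descent.
Variables (R : realType) (m : nat) (A B : 'M[R]_m.+2) (lam : 'I_m.+2 -> R).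
Hypotheses (hA : spd A) (hB : spd B) (hlam : is_eigenvalues A lam).
Let l1 := lam ord0.
Let l2 := lam (inord 1).
Let ln := lam ord_max.
Hypothesis hl12 : l1 < l2.
Variables (u : 'cV[R]_m.+2) (numin numax : R).
Hypotheses (hu0 : u != 0) (hu : A *m u = l1 *: u) (hnu0 : 0 < numin).
Hypothesis hAB : forall x : 'cV[R]_m.+2,
  numin * qform B x <= qform A x /\ qform A x <= numax * qform B x.

Let T := isqrtmx B.
Let xs := xstar B u.
Let C := cos (dangle B u).
Let d := l1^-1 - ln^-1.
Let p x := dotc (T *m x) (T *m x).
Let q x := qform A (T *m x).
(** The excess of [rayleigh] over its value [- l1^-1] at [xs], written D in the overview. *)
Let gap x := l1^-1 - p x / q x.
Let a := af A B l1 u.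
Let gamma := gammaf A B numax l1 ln.
Let g := sgrad (rayleigh A B).

Let l1_gt0 : 0 < l1. Proof. exact: eigenvalues_gt0 hA hlam _. Qed.
Let ln_gt0 : 0 < ln. Proof. exact: eigenvalues_gt0 hA hlam _. Qed.
Let l2_gt0 : 0 < l2. Proof. exact: eigenvalues_gt0 hA hlam _. Qed.

Let d_gt0 : 0 < d.
Proof.
have l2n : l2 <= ln by apply: hlam.2; rewrite leq_ord.
by rewrite subr_gt0 ltf_pV2 ?posrE// (lt_le_trans hl12).
Qed.

Let uu_gt0 : 0 < dotc u u. Proof. exact: dotc_gt0. Qed.
Let cB_gt0 : 0 < cnorm B u. Proof. exact: cnorm_gt0. Qed.
Let ciB_gt0 : 0 < cnorm (invmx B) u.
Proof. by apply: cnorm_gt0 => //; exact: spd_invmx. Qed.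

(** On the sphere [qform B (T *m x)] equals 1, so the bounds on the pencil become bounds on [q]. *)
Lemma conj_bounds x : dotc x x = 1 -> numin <= q x <= numax.
Proof.
move=> x1; have [] := hAB (T *m x).
by rewrite -(dotc_isqrt hB) x1 !mulr1 => -> ->.
Qed.

Let q_gt0 x : dotc x x = 1 -> 0 < q x.
Proof. by move=> /conj_bounds/andP[h _]; apply: lt_le_trans h. Qed.

Let numax_gt0 : 0 < numax.
Proof.
have /conj_bounds/andP[h1 h2] := xstar_unit hB hu0.
exact: lt_le_trans hnu0 (le_trans h1 h2).
Qed.

Lemma gap_ge0 x : dotc x x = 1 -> 0 <= gap x.
Proof.
move=> x1; rewrite subr_ge0 ler_pdivrMr ?q_gt0// mulrC ler_pdivlMr// mulrC.
exact: (qform_ge_min hA hlam).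
Qed.

Lemma gap_le x : dotc x x = 1 -> gap x <= d.
Proof.
move=> x1; rewrite lerD2l lerN2 ler_pdivlMr ?q_gt0// mulrC ler_pdivrMr// mulrC.
exact: (qform_le_max hA hlam).
Qed.

Lemma sgrad_rayleigh x : dotc x x = 1 ->
  g x = - (2 / q x) *: (T *m (T *m x - (p x / q x) *: (A *m (T *m x)))).
Proof.
move=> x1; have q0 := q_gt0 x1.
rewrite /g /rayleigh sgrad_quotient_qform ?conj_sym ?invmx_sym//; last first.
  by rewrite qform_conj// gt_eqF.
rewrite qform_conj// -/T -/(q x) qform_isqrt// -/T -/(p x).
by rewrite mulmxBr -scalemxAr -(isqrtmx_sqr hB) -/T !mulmxA.
Qed.

Lemma sgrad_orth x : dotc x x = 1 -> dotc x (g x) = 0.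
Proof.
move=> x1; have q0 := q_gt0 x1; rewrite sgrad_rayleigh// dotcZr.
rewrite -[X in X *m (_ - _)](isqrtmx_sym hB) -dotc_mull !dotcP -qformE.
rewrite -/(q x) -/(p x) divfK ?gt_eqF// subrr mulr0//.
Qed.

(** The outer factor B^{-1/2} of the gradient turns x_star into a multiple of u. As u is an
    eigenvector of A, the residual paired with u carries the factor 1 - l1 * p / q = l1 * gap. *)
Lemma sgrad_xstar x : dotc x x = 1 ->
  - dotc (g x) xs = 2 * l1 * dotc u (T *m x) * gap x / (q x * cnorm B u).
Proof.
move=> x1; have q0 := q_gt0 x1; rewrite sgrad_rayleigh// dotcZl dotc_mull.
rewrite (isqrtmx_sym hB) /xs xstarE// -scalemxAr -/T.
rewrite [T *m (sqrtmx B *m u)]mulmxA isqrtmx_sqrt// mul1mx.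
rewrite !dotcP.
have -> : dotc (A *m (T *m x)) u = l1 * dotc (T *m x) u.
  by rewrite dotc_mull hA.1 hu dotcZr.
rewrite (dotcC _ u) /gap; field.
by rewrite !gt_eqF.
Qed.

Lemma sgrad_xstar_ge x : dotc x x = 1 -> 2 * a x * gap x <= - dotc (g x) xs.
Proof.
move=> x1; have q0 := q_gt0 x1; rewrite sgrad_xstar//.
rewrite /a /af cos_sdist// hnorm_sqr// enormE -/C -/xs -/T -/(q x).
have := dotc_isqrt_ge hB hu0 x1; rewrite -/C -/xs -/T /sin_dangle enormE.
set k := cnorm (invmx B) u; set c := dotc x xs; set b := dotc u (T *m x).
have w_gt0 := uu_gt0; set w := dotc u u in w_gt0 *; set z := cnorm B u => h.
(* Multiplying [dotc_isqrt_ge] by this factor produces exactly the coefficient [a] on the left. *)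
have w0 : 0 <= 2 * l1 * gap x * k / (q x * w).
  by rewrite mulr_ge0 ?mulr_ge0 ?gap_ge0 ?invr_ge0 ?mulr_ge0 // ltW.
have := ler_wpM2l w0 h; congr (_ <= _); field; rewrite ?gt_eqF// !gt_eqF.
Qed.

Lemma gammaE x : gamma x = numax * d / q x.
Proof. by rewrite /gamma /gammaf hnorm_sqr. Qed.

Lemma gamma_gt0 x : dotc x x = 1 -> 0 < gamma x.
Proof. by move=> x1; rewrite gammaE divr_gt0 ?q_gt0// mulr_gt0. Qed.

(* The factor is 4 rather than the 2 of a gamma-smooth function: near x_star the
   ratio |g|^2 / gap can approach 4 gamma, so a step of length eta may come close
   to the reflection of x in x_star, and only the factor 1 - gap x / d makes the
   distance decrease strictly. *)
Lemma sgrad_sqr_le x : dotc x x = 1 ->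
  dotc (g x) (g x) <= 4 * gamma x * (gap x * (1 - gap x / d)).
Proof.
move=> x1; have q0 := q_gt0 x1; rewrite sgrad_rayleigh// gammaE.
set w := T *m x; set rho := p x / q x; set r := w - rho *: _.
rewrite dotcZl dotcZr -qform_isqrt//.
(* Give the eigenvalue l_i of A the weight l_i y_i^2 / q, with y_i the coordinates of w. Then rho is
   the mean of the inverse eigenvalues and the left side is q times their variance, bounded by (1/l1
   - rho) * (rho - 1/ln) = gap * (d - gap). *)
have hr : qform (invmx A) r <= q x * (gap x * (d - gap x)).
  have Au := spd_unit hA.
  have -> : qform (invmx A) r = qform (invmx A) w - rho ^+ 2 * q x.
    rewrite !qformE /r mulmxBr -scalemxAr mulKmx// !dotcP.
    have -> : dotc (A *m w) (invmx A *m w) = dotc w w.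
      by rewrite dotc_mull hA.1 mulKVmx.
    rewrite dotcC -/(p x) (dotcC (A *m w) w) -qformE -/(q x).
    by rewrite /rho; field; rewrite gt_eqF.
  have := qform_invmx_le hA hlam w; rewrite -/l1 -/ln -/(q x) -/(p x).
  move=> h; rewrite lerBlDr (le_trans h)// le_eqVlt; apply/orP; left; apply/eqP.
  have pE : p x = rho * q x by rewrite divfK// gt_eqF.
  by rewrite (_ : gap x = l1^-1 - rho)// pE /d; ring.
have h2 := qform_invmx_antitone hA hB (fun z => (hAB z).2) r.
have h3 : qform (invmx B) r <= numax * (q x * (gap x * (d - gap x))).
  by apply: le_trans h2 _; rewrite ler_pM2l.
have h4 : 0 <= (2 / q x) ^+ 2 by rewrite sqr_ge0.
have := ler_wpM2l h4 h3; congr (_ <= _); first by ring.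
by field; rewrite !gt_eqF.
Qed.

Lemma af_gt0 x : dotc x x = 1 -> C < dotc x xs -> 0 < a x.
Proof.
move=> x1 cx; rewrite /a /af cos_sdist// hnorm_sqr// enormE.
by rewrite divr_gt0// ?mulr_gt0 ?exprn_gt0 ?subr_gt0// q_gt0.
Qed.

(** [geodesic_step_ineq] is applied with k = 1 - gap / d, which leaves the fraction gap / d of P as
    the guaranteed gain. *)
Lemma descent_step x (eta := a x / gamma x) : dotc x x = 1 -> C < dotc x xs ->
  dotc x xs + cos 1 ^+ 2 * (gap x / d * (2 * eta * a x * gap x))
    <= dotc (sexp x (- eta *: g x)) xs.
Proof.
move=> x1 cx; have C0 : 0 <= C by exact: cos_dangle_ge0.
have g0 := gamma_gt0 x1; have a0 := af_gt0 x1 cx.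
have eta0 : 0 < eta by rewrite divr_gt0.
have hG := sgrad_xstar_ge x1; have hg := sgrad_sqr_le x1.
have D0 := gap_ge0 x1; have Dd := gap_le x1.
rewrite /sexp; have [v0|v0] := eqVneq.
  (* In this case [sexp] leaves x in place. A zero gradient forces the gap to vanish because a > 0,
     so no gain is claimed. *)
  have gx0 : g x = 0.
    by move/eqP: v0; rewrite scaler_eq0 oppr_eq0 gt_eqF//= => /eqP.
  have gap0 : gap x = 0.
    apply/eqP; rewrite eq_le D0 andbT; move: hG; rewrite gx0.
    rewrite -(scale0r x) dotcZl mul0r oppr0 -mulrA pmulr_rle0//.
    by rewrite pmulr_rle0.
  by rewrite gap0 !mul0r mulr0 addr0.
set v := - eta *: g x in v0 *; set s := enorm v.
have s0 : 0 < s by rewrite sqrtr_gt0 dotc_gt0.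
have s2 : s ^+ 2 = eta ^+ 2 * dotc (g x) (g x).
  by rewrite enormE /v dotcZl dotcZr; ring.
have E : dotc v xs = eta * - dotc (g x) xs by rewrite /v dotcZl; ring.
set P := 2 * eta * a x * gap x.
have P0 : 0 <= P by rewrite /P mulr_ge0// ltW// mulr_gt0// mulr_gt0.
have PE : P <= dotc v xs.
  rewrite E; have := ler_wpM2l (ltW eta0) hG; congr (_ <= _); rewrite /P; ring.
have sP : s ^+ 2 <= 2 * (1 - gap x / d) * P.
  rewrite s2; have := ler_wpM2l (sqr_ge0 eta) hg; congr (_ <= _).
  by rewrite /P /eta; field; rewrite !gt_eqF.
have k1 : 1 - gap x / d <= 1 by rewrite lerBlDr lerDl divr_ge0// ltW.
have sc : (s / 2) ^+ 2 <= 1 - dotc x xs ^+ 2.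
  have xv : dotc v x = 0 by rewrite /v dotcZl dotcC sgrad_orth// mulr0.
  have xs1 : dotc xs xs = 1 by exact: xstar_unit.
  (* As v is orthogonal to x, it sees only the component of xs orthogonal to x, of squared norm 1 -
     c^2. Combined with s^2 / 2 <= P <= <v, xs>, this gives the bound after division by s^2. *)
  have := CauchySchwarz v (xs - dotc x xs *: x).
  rewrite -enormE -/s; move: xs1 xv PE; rewrite -/s.
  clearbody xs v => xs1 xv PE; rewrite !dotcP xs1 xv x1 (dotcC xs x).
  set c := dotc x xs => h.
  have h1 : dotc v xs ^+ 2 <= s ^+ 2 * (1 - c ^+ 2) by move: h; lra.
  have s2P : s ^+ 2 / 2 <= P.
    have : (1 - gap x / d) * P <= P by rewrite ler_piMl.
    by move: sP; lra.
  have h2 : (s ^+ 2 / 2) ^+ 2 <= dotc v xs ^+ 2.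
    have ss0 : 0 <= s ^+ 2 / 2 by rewrite divr_ge0 ?sqr_ge0.
    have sv := le_trans s2P PE.
    by rewrite ler_pXn2r// nnegrE// (le_trans ss0).
  have := le_trans h2 h1.
  rewrite (_ : (s ^+ 2 / 2) ^+ 2 = s ^+ 2 * (s / 2) ^+ 2); last by field.
  by rewrite ler_pM2l// exprn_gt0.
have c0 := le_trans C0 (ltW cx).
have := geodesic_step_ineq s0 c0 sc k1 P0 PE sP.
rewrite dotcDl !dotcZl; congr (_ <= _).
by congr (_ + _ * _); ring.
Qed.


(** Split w = b u + y with y orthogonal to u. Only y contributes to the gap, the bound by l2 keeps
    at least the fraction 1 - l1 / l2 of [qform A y], and [qform A y] controls [qform B y]. *)
Lemma one_sub_sqr_dotc_xstar_le x : dotc x x = 1 ->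
  numin * (1 - l1 / l2) * (1 - dotc x xs ^+ 2) <= numax * l1 * gap x.
Proof.
move=> x1; have q0 := q_gt0 x1; have /andP[_ qmax] := conj_bounds x1.
set w := T *m x; pose b := dotc u w / dotc u u; pose y := w - b *: u.
have uy : dotc u y = 0.
  by rewrite /y dotcDr dotcNr dotcZr /b divfK ?subrr// gt_eqF.
have hy := qform_ge_second hA hlam hl12 hu0 hu uy; rewrite -/l2 in hy.
have [hBy _] := hAB y.
have hw : w = b *: u + y by rewrite /y addrC subrK.
have e1 : p x = b ^+ 2 * dotc u u + dotc y y.
  by rewrite /p -/w hw; move: uy; clearbody y => uy; rewrite !dotcP (dotcC y) uy; ring.
have e2 : q x = b ^+ 2 * (l1 * dotc u u) + qform A y.
  rewrite /q -/w hw qform_line; last exact: hA.1.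
  have -> : dotc u (A *m y) = 0.
    by rewrite dotcC dotc_mull hA.1 hu dotcZr dotcC uy mulr0.
  by rewrite (qformE A u) hu dotcZr; ring.
have e3 : qform A y - l1 * dotc y y = q x * l1 * gap x.
  have -> : q x * l1 * gap x = q x - l1 * p x.
    by rewrite /gap; field; rewrite !gt_eqF.
  by rewrite e1 e2; ring.
(* B^{1/2} y is x minus a multiple of xs, so its norm is at least the distance from x to the line of
   xs. *)
have By : 1 - dotc x xs ^+ 2 <= qform B y.
  have Sy : sqrtmx B *m y = x - (b * cnorm B u) *: xs.
    rewrite /y mulmxBr /w mulmxA (sqrtmx_isqrt hB) mul1mx -scalemxAr /xs xstarE//.
    by rewrite scalerA mulfK// gt_eqF.
  have -> : qform B y = dotc (sqrtmx B *m y) (sqrtmx B *m y).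
    by rewrite dotc_mull (sqrtmx_sym hB) mulmxA (sqrtmxP hB).2 qformE.
  have xs1 : dotc xs xs = 1 by exact: xstar_unit.
  rewrite Sy; move: xs1; clearbody xs => xs1.
  rewrite !dotcP x1 xs1 (dotcC xs x).
  have := sqr_ge0 (dotc x xs - b * cnorm B u); lra.
have k0 : 0 <= 1 - l1 / l2 by rewrite subr_ge0 ler_pdivrMr// mul1r ltW.
have h1 : numin * (1 - dotc x xs ^+ 2) <= qform A y.
  by apply: le_trans hBy; rewrite ler_pM2l.
have h2 : (1 - l1 / l2) * qform A y <= q x * l1 * gap x.
  rewrite -e3 mulrBl mul1r lerD2l lerN2 -mulrA ler_pM2l// mulrC ler_pdivlMr//.
  by rewrite mulrC.
have h3 : q x * l1 * gap x <= numax * l1 * gap x.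
  by rewrite -!mulrA ler_wpM2r// mulr_ge0 ?gap_ge0// ltW.
apply: le_trans h3; apply: le_trans h2.
by rewrite [numin * _]mulrC -mulrA ler_wpM2l.
Qed.

(** A fixed margin above C keeps [a] away from 0. All other factors are bounded on the sphere, so
    the gain dominates the square of the gap and hence of 1 - c^2. *)
Lemma descent_rate c0 : C < c0 -> exists2 K, 0 < K &
  forall x, dotc x x = 1 -> c0 <= dotc x xs ->
    K * (1 - dotc x xs ^+ 2) ^+ 2 <=
    cos 1 ^+ 2 * (gap x / d * (2 * (a x / gamma x) * a x * gap x)).
Proof.
move=> Cc0.
(* [a0] is [a] with the cosine lowered to c0 and [q] raised to numax; [K1] is the constant of
   [one_sub_sqr_dotc_xstar_le], and [K2] uses [q] >= numin. *)
pose a0 := l1 * cnorm (invmx B) u ^+ 2 * (c0 - C) / (numax * dotc u u).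
have a00 : 0 < a0 by rewrite divr_gt0 ?mulr_gt0 ?exprn_gt0 ?subr_gt0.
pose K1 := numin * (1 - l1 / l2) / (numax * l1).
have l12 : 0 < 1 - l1 / l2 by rewrite subr_gt0 ltr_pdivrMr// mul1r.
have K10 : 0 < K1 by rewrite divr_gt0 ?mulr_gt0.
pose K2 := cos 1 ^+ 2 * (2 * a0 ^+ 2 * numin / (numax * d ^+ 2)).
have K20 : 0 < K2.
  have a02 : 0 < a0 ^+ 2 by rewrite exprn_gt0.
  have d02 : 0 < d ^+ 2 by rewrite exprn_gt0.
  have c12 : 0 < cos 1 ^+ 2 :> R by rewrite exprn_gt0 ?cos1_gt0.
  by rewrite mulr_gt0// divr_gt0// mulr_gt0// mulr_gt0.
exists (K2 * K1 ^+ 2) => [|x x1 cx]; first by rewrite mulr_gt0 ?exprn_gt0.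
have q0 := q_gt0 x1; have /andP[qmin qmax] := conj_bounds x1.
have /andP[_ cle1] := dotc_xstar_le1 hB hu0 x1.
have C0 : 0 <= C by exact: cos_dangle_ge0.
have ax : a0 <= a x.
  rewrite /a /af cos_sdist// hnorm_sqr// enormE -/C -/xs -/T -/(q x) /a0.
  apply: ler_pM.
  - by rewrite mulr_ge0 ?mulr_ge0 ?sqr_ge0 ?subr_ge0// ltW.
  - by rewrite invr_ge0 mulr_ge0 ?ltW.
  - by rewrite ler_pM2l ?mulr_gt0 ?exprn_gt0// lerD2r.
  - by rewrite lef_pV2 ?posrE ?mulr_gt0// ler_pM2r.
have r0 : 0 <= 1 - dotc x xs ^+ 2.
  by rewrite subr_ge0 expr_le1// (le_trans C0)// ltW// (lt_le_trans Cc0).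
have gx : K1 * (1 - dotc x xs ^+ 2) <= gap x.
  have := one_sub_sqr_dotc_xstar_le x1; move=> h.
  rewrite /K1 (mulrAC (numin * (1 - l1 / l2))) ler_pdivrMr ?mulr_gt0//.
  by rewrite (mulrC (gap x)).
have g2 : (K1 * (1 - dotc x xs ^+ 2)) ^+ 2 <= gap x ^+ 2.
  by rewrite ler_pXn2r ?nnegrE ?gap_ge0 ?(mulr_ge0 (ltW K10)).
rewrite -[leLHS]mulrA -exprMn.
apply: (@le_trans _ _ (K2 * gap x ^+ 2)); first by rewrite ler_pM2l.
rewrite /K2 -[leLHS]mulrA ler_pM2l ?exprn_gt0 ?cos1_gt0//.
have -> : gap x / d * (2 * (a x / gamma x) * a x * gap x) =
    2 * a x ^+ 2 * q x / (numax * d ^+ 2) * gap x ^+ 2.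
  by rewrite gammaE; field; rewrite !gt_eqF.
rewrite ler_wpM2r ?sqr_ge0// ler_pM2r ?invr_gt0 ?mulr_gt0 ?exprn_gt0//.
apply: ler_pM; [|exact: ltW| |exact: qmin]; first by rewrite mulr_ge0 ?sqr_ge0.
by rewrite ler_pM2l// ler_pXn2r// nnegrE ltW// (lt_le_trans a00).
Qed.

(** * Convergence of the iterates *)

Section Iteration.
Variables (x : nat -> 'cV[R]_m.+2).
Hypotheses (hx0 : dotc (x 0%N) (x 0%N) = 1) (hc0 : C < dotc (x 0%N) xs).
Hypothesis hx : forall t, x t.+1 = sexp (x t) (- (a (x t) / gamma (x t)) *: g (x t)).

(** Each step increases the cosine weakly, so the iterates stay in the region where [descent_step]
    applies, with the margin fixed by the start. *)
Lemma iteration_inv t :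
  dotc (x t) (x t) = 1 /\ dotc (x 0%N) xs <= dotc (x t) xs.
Proof.
elim: t => [//|t [x1 cx]]; rewrite hx; split.
  by rewrite sexp_unit// dotcZr sgrad_orth// mulr0.
have Cx := lt_le_trans hc0 cx.
apply: le_trans (descent_step x1 Cx); rewrite (le_trans cx)// lerDl.
have D0 := gap_ge0 x1; have a0 := af_gt0 x1 Cx; have g0 := gamma_gt0 x1.
apply: mulr_ge0; first exact: sqr_ge0.
apply: mulr_ge0; first by rewrite divr_ge0// ltW.
by rewrite mulr_ge0// ltW// mulr_gt0// mulr_gt0// divr_gt0.
Qed.

Lemma cvg_dotc_xstar : dotc (x t) xs @[t --> \oo] --> (1 : R).
Proof.
have [K K0 hK] := descent_rate hc0.
apply: (cvg_increments_to1 K0) => [|t|t].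
- by apply: le_lt_trans hc0; exact: cos_dangle_ge0.
- have [x1 _] := iteration_inv t.
  by have /andP[] := dotc_xstar_le1 hB hu0 x1.
- have [x1 cx] := iteration_inv t; have Cx := lt_le_trans hc0 cx.
  rewrite hx; apply: le_trans (descent_step x1 Cx).
  by rewrite lerD2l hK.
Qed.

(** [hnorm] is the square root of the quadratic form [q], so the second-order expansion of [q] at xs
    is exact and its error is controlled by the distance to xs. *)
Lemma cvg_hnorm : hnorm A B (x t) @[t --> \oo] --> cnorm A u / cnorm B u.
Proof.
have xs1 : dotc xs xs = 1 by exact: xstar_unit.
have qxs : q xs = (cnorm A u / cnorm B u) ^+ 2.
  rewrite /q /xs xstarE// -scalemxAr mulmxA (isqrtmx_sqrt hB) mul1mx.
  rewrite qformE -scalemxAr dotcZl dotcZr -qformE -cnormE//; field.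
  by rewrite gt_eqF.
have -> : cnorm A u / cnorm B u = Num.sqrt (q xs).
  by rewrite qxs sqrtr_sqr ger0_norm// divr_ge0// sqrtr_ge0.
have -> : (fun t => hnorm A B (x t)) = (fun t => Num.sqrt (q (x t))).
  by apply/funext => t; rewrite /q -hnorm_sqr// sqrtr_sqr ger0_norm// sqrtr_ge0.
apply: (@continuous_cvg _ _ _ _ _ _ (@Num.sqrt R)); first exact: sqrt_continuous.
(* [z] is half the gradient of [q] at xs, and [e t] is the squared Euclidean distance from the
   iterate to xs. *)
pose z := T *m A *m T *m xs; pose e t := 2 - 2 * dotc (x t) xs.
have ce : e t @[t --> \oo] --> (0 : R).
  rewrite (_ : 0 = 2 - 2 * 1); last by rewrite mulr1 subrr.
  apply: cvgB; first exact: cvg_cst.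
  by apply: cvgM; [exact: cvg_cst|exact: cvg_dotc_xstar].
have es : Num.sqrt (e t) @[t --> \oo] --> (0 : R).
  rewrite -[X in _ --> X](@sqrtr0 R).
  by apply: (@continuous_cvg _ _ _ _ _ _ (@Num.sqrt R)) ce; exact: sqrt_continuous.
have bnd t : `|q (x t) - q xs| <= 2 * (Num.sqrt (e t) * enorm z) + numax * e t.
  have [x1 _] := iteration_inv t; pose v := x t - xs.
  have vv : dotc v v = e t.
    rewrite /v /e; clearbody xs; rewrite !dotcP x1 xs1 (dotcC xs); ring.
  have -> : q (x t) - q xs = 2 * dotc v z + qform A (T *m v).
    have -> : x t = 1 *: v + xs by rewrite scale1r subrK.
    rewrite /q -!(qform_conj A hB) (qform_line _ _ _ (conj_sym hA hB)) /z -/T.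
    ring.
  have h1 : `|dotc v z| <= Num.sqrt (e t) * enorm z.
    rewrite -vv -sqrtrM ?dotc_ge0// -sqrtr_sqr ler_sqrt ?CauchySchwarz//.
    by rewrite mulr_ge0// dotc_ge0.
  have [_ h2] := hAB (T *m v); rewrite -(dotc_isqrt hB) vv in h2.
  have h3 : 0 <= qform A (T *m v) by exact: spd_ge0.
  apply: le_trans (ler_normD _ _) _; rewrite normrM ger0_norm// (ger0_norm h3).
  by rewrite lerD// ler_pM2l.
apply/cvgrPdist_le => /= eps eps0.
have cb : 2 * (Num.sqrt (e t) * enorm z) + numax * e t @[t --> \oo] --> (0 : R).
  rewrite (_ : 0 = 2 * (0 * enorm z) + numax * 0); last by rewrite mul0r !mulr0 addr0.
  apply: cvgD; last by apply: cvgM => //; exact: cvg_cst.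
  by apply: cvgM; [exact: cvg_cst|apply: cvgM => //; exact: cvg_cst].
move/cvgrPdist_le : cb => /(_ _ eps0); apply: filterS => t /=.
rewrite sub0r normrN => h; rewrite distrC; apply: le_trans (bnd t) _.
exact: le_trans (ler_norm _) h.
Qed.

End Iteration.
End Descent.

(** * Identification of the limit *)

Theorem proposition15 (R : realType) (m : nat) (n := m.+2)
    (A B : 'M[R]_n) (hA : spd A) (hB : spd B)
    (lam : 'I_n -> R) (hlam : is_eigenvalues A lam)
    (l1 := lam ord0) (l2 := lam (inord 1)) (ln := lam ord_max)
    (hl1 : 0 < l1) (hl12 : l1 < l2)
    (u : 'cV[R]_n) (hu0 : u != 0) (hu : A *m u = l1 *: u)
    (numin numax : R) (hnu0 : 0 < numin) (hnu : numin <= numax)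
    (hAB : forall x : 'cV[R]_n,
        numin * qform B x <= qform A x /\ qform A x <= numax * qform B x)
    (a := af A B l1 u) (gamma := gammaf A B numax l1 ln)
    (mu := muf A B numin l1 l2 u)
    (phi := dangle B u) (xs := xstar B u)
    (x : nat -> 'cV[R]_n) (eta : nat -> R)
    (hx0 : x 0%N \in sphere R n) (hdist : sdist (x 0%N) xs < phi)
    (heta : forall t, eta t = a (x t) / gamma (x t))
    (hx : forall t,
        x t.+1 = sexp (x t) (- eta t *: sgrad (rayleigh A B) (x t)))
    (xi := fun t : nat => eta t * mu (x t) * a (x t))
    (kappa := numax / numin) :
  xi t @[t --> \oo] -->
    8 / (pi ^+ 2 * (1 + cos phi) ^+ 2)
    * ((l1^-1 - l2^-1) / (kappa * (l1^-1 - ln^-1))).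
Proof.
have x1 : dotc (x 0%N) (x 0%N) = 1.
  by move: hx0; rewrite inE /sphere/= -enormE => ->; rewrite expr1n.
have hc0 := sdist_lt_dangle hB hu0 x1 hdist.
have hx' t : x t.+1 =
    sexp (x t) (- (a (x t) / gamma (x t)) *: sgrad (rayleigh A B) (x t)).
  by rewrite hx heta.
have cc := cvg_dotc_xstar hA hB hlam hl12 hu0 hu hnu0 hAB x1 hc0 hx'.
have ch := cvg_hnorm hA hB hlam hl12 hu0 hu hnu0 hAB x1 hc0 hx'.
have inv := iteration_inv hA hB hlam hl12 hu0 hu hnu0 hAB x1 hc0 hx'.
have iB := spd_invmx hB.
set h := cnorm A u / cnorm B u in ch; set C := cos phi.
pose k := cnorm (invmx B) u; pose w := dotc u u.
pose d := l1^-1 - ln^-1; pose d12 := l1^-1 - l2^-1.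
have cA0 : 0 < cnorm A u by exact: cnorm_gt0.
have cB0 : 0 < cnorm B u by exact: cnorm_gt0.
have k0 : 0 < k by exact: cnorm_gt0.
have w0 : 0 < w by exact: dotc_gt0.
have h0 : 0 < h by rewrite divr_gt0.
have C0 : 0 <= C by exact: cos_dangle_ge0.
have l20 : 0 < l2 by exact: eigenvalues_gt0 hA hlam _.
have ln0 : 0 < ln by exact: eigenvalues_gt0 hA hlam _.
have numax0 : 0 < numax := lt_le_trans hnu0 hnu.
have d0 : 0 < d.
  have l2n : l2 <= ln by apply: hlam.2; rewrite leq_ord.
  by rewrite subr_gt0 ltf_pV2 ?posrE// (lt_le_trans hl12).
have pi0 : 0 < pi :> R by exact: pi_gt0.
(* [K] collects the constant factors. The powers of [hnorm] are -4 from the two factors [a], 2 from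
   1 / gamma and -1 from mu, which leaves -3. *)
pose K := (l1 * k ^+ 2 / w) ^+ 2 / (numax * d)
  * (8 * numin * d12 * cnorm B u / (pi ^+ 2 * cnorm A u)).
have hn t : 0 < hnorm A B (x t).
  rewrite lt_def sqrtr_ge0 andbT -(@sqrf_eq0 R) hnorm_sqr// gt_eqF//.
  have /andP[hq _] := conj_bounds hB hAB (inv t).1.
  exact: lt_le_trans hq.
have -> : xi = fun t => K * (dotc (x t) xs - C) ^+ 2 / hnorm A B (x t) ^+ 3.
  apply/funext => t; rewrite /xi heta /a /gamma /mu /af /gammaf /muf.
  rewrite cos_sdist ?(inv t).1// enormE -/C -/k -/w -/d -/d12 -/xs /K.
  have /lt0r_neq0 := hn t; set H := hnorm _ _ _ => H0.
  by move: (@pi R) pi0 => P P0; field; rewrite H0 !gt_eqF.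
have -> : 8 / (pi ^+ 2 * (1 + C) ^+ 2) * (d12 / (kappa * d)) =
    K * (1 - C) ^+ 2 / h ^+ 3.
  have CE : C ^+ 2 = 1 - (w / (cnorm B u * k)) ^+ 2.
    by rewrite cos_dangle_sqr// /sin_dangle enormE.
  have cA2 : cnorm A u ^+ 2 = l1 * w by rewrite cnormE// qformE hu dotcZr.
  have -> : K * (1 - C) ^+ 2 / h ^+ 3 = 8 * numin * d12 / (pi ^+ 2 * numax * d)
      * (l1 * k ^+ 2 * cnorm B u ^+ 2 * (1 - C) / (w * cnorm A u ^+ 2)) ^+ 2.
    by rewrite /K /h; move: (@pi R) pi0 => P P0; field; rewrite !gt_eqF.
  (* This is sin^2 phi = (1 - cos phi) * (1 + cos phi); it cancels the factor 1 - C of the limit and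
     leaves (1 + C)^-1. *)
  have wE : w ^+ 2 = (k * cnorm B u) ^+ 2 * ((1 - C) * (1 + C)).
    rewrite (_ : (1 - C) * (1 + C) = 1 - C ^+ 2); last by ring.
    by rewrite CE; field; rewrite !gt_eqF.
  have C1 : 1 + C != 0 by rewrite gt_eqF// ltr_pwDl.
  have -> : l1 * k ^+ 2 * cnorm B u ^+ 2 * (1 - C) / (w * cnorm A u ^+ 2)
      = (1 + C)^-1.
    rewrite cA2 (_ : w * (l1 * w) = l1 * w ^+ 2); last by ring.
    have := exprn_gt0 2 w0; rewrite wE => h2.
    (* If C were 1, [wE] would make w vanish. *)
    have C2 : 1 - C != 0.
      by apply: contraTneq h2 => ->; rewrite mul0r mulr0 ltxx.
    by field; rewrite C1 C2 !gt_eqF.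
  by rewrite /kappa; move: (@pi R) pi0 => P P0; field; rewrite C1 !gt_eqF.
apply: cvgM.
  apply: cvgM; first exact: cvg_cst.
  have c1 : (dotc (x t) xs - C) @[t --> \oo] --> 1 - C.
    by apply: cvgB => //; exact: cvg_cst.
  by rewrite expr2; apply: cvgM.
apply: cvgV; first by rewrite expf_neq0// gt_eqF.
have h2 : hnorm A B (x t) * (hnorm A B (x t) * hnorm A B (x t)) @[t --> \oo]
   --> h * (h * h) by apply: cvgM => //; apply: cvgM.
exact: h2.
Qed.
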